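(* There exist a bounded, non-pseudoconvex domain $\Omega\subset\mathbb C^2$ with a $\mathcal C^{1,1}$-smooth boundary, and a closed set $E\subset\partial\Omega$, such that $\partial\Omega\setminus E$ is dense in $\partial\Omega$, $\mathcal C^2$-smooth, and strictly pseudoconvex in a neighborhood of each of its points.
   Context: A boundary is $\mathcal C^{1,1}$-smooth (respectively $\mathcal C^2$-smooth near a point) if it is locally given by a defining function (negative exactly on the domain) with nonvanishing gradient which is continuously differentiable with Lipschitz first-order partial derivatives (respectively twice continuously differentiable). Strictly pseudoconvex at a $\mathcal C^2$-smooth boundary point means that the Levi form of a local $\mathcal C^2$ defining function is positive definite on the complex tangent space to the boundary at that point. *)

(* Defs.v *)
From HB Require Import structures.
From mathcomp Require Import all_boot all_order all_algebra.
From mathcomp Require Import complex.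
From mathcomp Require Import all_classical all_reals all_analysis.

Set Implicit Arguments.
Unset Strict Implicit.
Unset Printing Implicit Defensive.

Import Order.TTheory GRing.Theory Num.Theory.
Import numFieldNormedType.Exports.

Local Open Scope classical_set_scope.
Local Open Scope ring_scope.
Local Open Scope complex_scope.

(* The regular algebra R[i]^o carries the normed-module structure, so that Cn R n
   is a normed module over R[i] (for the maximum of the moduli of the coordinates,
   which induces the usual topology of C^n). *)
Notation Cn R n := 'rV[R[i]^o]_n.

Section Domains.
Context {R : realType} {n : nat}.
Implicit Types (Om U E : set (Cn R n)) (f rho u : Cn R n -> R) (g : Cn R n -> R[i]).
Implicit Types (p q z w : Cn R n).

Definition boundary (A : set (Cn R n)) : set (Cn R n) := closure A `\` interior A.

Definition domain Om : Prop := [/\ open Om, connected Om & Om !=set0].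

(* With z_j = x_j + i y_j, the direction of x_j (b = false) or of y_j (b = true). *)
Definition coord_dir (b : bool) (j : 'I_n) : Cn R n :=
  ((if b then 'i else 1) : R[i]) *: delta_mx 0 j.

Definition along f (b : bool) (j : 'I_n) p : R -> R :=
  fun t => f (p + t%:C *: coord_dir b j).

Definition partial (b : bool) (j : 'I_n) f p : R := derive1 (along f b j p) 0.

Definition C1_on U f : Prop :=
  (forall b j p, U p -> derivable (along f b j p) 0 1) /\
  (forall b j p, U p -> {for p, continuous (partial b j f)}).

Definition C2_on U f : Prop :=
  C1_on U f /\ forall b j, C1_on U (partial b j f).

Definition C11_on U f : Prop :=
  C1_on U f /\
  forall b j, exists L : R, forall p q, U p -> U q ->
    `|partial b j f p - partial b j f q| <= L * complex.Re `|p - q|.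

(* Only the values of rho on U matter. *)
Definition local_defining Om U rho : Prop :=
  [/\ open U,
      forall z, U z -> (Om z <-> rho z < 0) &
      forall z, U z -> exists b j, partial b j rho z != 0].

Definition C11_smooth_boundary Om : Prop :=
  forall p, boundary Om p ->
    exists U rho, [/\ U p, local_defining Om U rho & C11_on U rho].

Definition C2_smooth_at Om p : Prop :=
  exists U rho, [/\ U p, local_defining Om U rho & C2_on U rho].

Definition cpartial (b : bool) (j : 'I_n) g p : R[i] :=
  partial b j (fun z => complex.Re (g z)) p +i*
  partial b j (fun z => complex.Im (g z)) p.

(* Wirtinger derivatives, with respect to z_j and to its conjugate. *)
Definition dz (j : 'I_n) g p : R[i] :=
  2^-1 * (cpartial false j g p - 'i * cpartial true j g p).

Definition dzbar (j : 'I_n) g p : R[i] :=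
  2^-1 * (cpartial false j g p + 'i * cpartial true j g p).

Definition complex_tangent rho p w : Prop :=
  \sum_j dz j (fun z => (rho z)%:C) p * w 0 j = 0.

Definition levi_form rho p w : R[i] :=
  \sum_j \sum_k dz j (dzbar k (fun z => (rho z)%:C)) p * w 0 j * conjc (w 0 k).

(* The Levi form of a C^2 function is Hermitian, hence real-valued on the diagonal;
   taking its real part loses nothing. *)
Definition strictly_pseudoconvex_at Om p : Prop :=
  exists U rho,
    [/\ U p, local_defining Om U rho, C2_on U rho &
        forall w, w != 0 -> complex_tangent rho p w ->
          0 < complex.Re (levi_form rho p w)].

Definition cis (t : R) : R[i] := cos t +i* sin t.

(* Subharmonicity on complex lines, as the sub-mean value inequality on every closed
   disc {a + s w : |s| <= 1} contained in Om. *)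
Definition continuous_psh Om u : Prop :=
  (forall z, Om z -> {for z, continuous u}) /\
  forall a w : Cn R n, (forall s : R[i], `|s| <= 1 -> Om (a + s *: w)) ->
    u a <= (2 * pi)^-1 *
      \int[lebesgue_measure]_(t in `[0, 2 * pi]) u (a + cis t *: w).

(* Existence of a continuous plurisubharmonic exhaustion function: all the sublevel
   sets are relatively compact in Om. *)
Definition pseudoconvex Om : Prop :=
  exists u, continuous_psh Om u /\
    forall c : R, let S := [set z | Om z /\ u z < c] in
      precompact S /\ closure S `<=` Om.

End Domains.

(* Main.v *)
(* The domain is
     { |z_1|^2 + |z_2|^2 - psi (Re z_1) - psi (Im z_1) < 2500 },
   where psi is C^{1,1} and psi'' vanishes off a compact nowhere dense set K of
   positive measure. Off K the defining function is locally the squared norm plus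
   an affine function, so its Levi form is the standard Hermitian form. But K is
   so fat around 0 that psi t >= 2 t^2 on [-1, 1], so that on a disc
   |z_1| <= 1, z_2 = s, the defining function is larger at the centre than on the
   boundary circle. As s increases to 50 the boundary circles stay in a compact
   subset of the domain whereas the centres tend to the boundary point (0, 50);
   by the sub-mean value property no plurisubharmonic exhaustion exists. *)
Require Import Defs.
From mathcomp Require Import all_boot all_order all_algebra.
From mathcomp Require Import complex.
From mathcomp Require Import all_classical all_reals all_analysis.
From mathcomp Require Import ring lra measurable_realfun.
Import Order.TTheory GRing.Theory Num.Theory.
Import numFieldNormedType.Exports.
Local Open Scope classical_set_scope.
Local Open Scope ring_scope.

(** * A profile with an exceptional Cantor set *)

Section RealLine.
Context {R : realType}.
Notation mu := (@lebesgue_measure R).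

(* The interval around the rational q has radius proportional to |q|: this makes
   the union thin around 0 at every scale. *)
Lemma sparse_open_dense : exists U : set R,
  [/\ open U,
      forall x e : R, 0 < e -> exists2 y, U y & `|x - y| < e &
      forall (t : R) (I : set R), 0 <= t -> measurable I ->
        I `<=` [set s | `|s| <= t] -> (mu (U `&` I) <= (t / 2)%:E)%E].
Proof.
(* Codes of no rational default to 0, whose interval has radius 0 and is empty. *)
pose q k : R := ratr (odflt 0 (unpickle k : option rat)).
pose e k : R := `|q k| / 16 / (2 ^ k)%:R.
have e0 k : 0 <= e k by rewrite !divr_ge0.
have eq k : e k <= `|q k| / 16.
  rewrite /e ler_pdivrMr ?ltr0n ?expn_gt0//.
  by rewrite ler_peMr ?divr_ge0// ler1n expn_gt0.
exists (\bigcup_k ball (q k) (e k)); split.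
- by apply: bigcup_open => k _; exact: ball_open.
- move=> x d d0.
  (* The rational 0 has an empty interval, so the search is restricted to a one-sided interval at
     [x] that avoids 0. *)
  have [a [b [ab abd ab0]]] : exists a b : R, [/\ a < b, 
      (forall y, a < y < b -> `|x - y| < d) & forall y, a < y < b -> y != 0].
    have [x0|x0] := leP 0 x.
      exists x, (x + d); split; first by rewrite ltrDl.
        by move=> y /andP[xy yx]; rewrite ltr0_norm; lra.
      by move=> y /andP[xy yx]; rewrite gt_eqF//; lra.
    exists (x - d), x; split; first by lra.
      by move=> y /andP[xy yx]; rewrite gtr0_norm; lra.
    by move=> y /andP[xy yx]; rewrite lt_eqF//; lra.
  have [r] := rat_in_itvoo ab; rewrite in_itv/= => rab.
  exists (ratr r); last exact: abd.
  exists (pickle r) => //.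
  have qr : q (pickle r) = ratr r by rewrite /q pickleK.
  rewrite /ball/= qr subrr normr0 /e qr !divr_gt0 ?normr_gt0 ?ab0//.
- move=> t J t0 mJ Jt.
  have mB k : measurable (ball (q k) (e k)) by exact: measurable_ball.
  have /le_trans -> // : (mu (\bigcup_k ball (q k) (e k) `&` J) <=
     \sum_(0 <= k <oo) mu (ball (q k) (e k) `&` J))%E.
    apply: (measure_sigma_subadditive mu) => [k||].
    - exact: (measurableI _ _ (mB k) mJ).
    - by apply: (measurableI _ _ _ mJ); apply: bigcup_measurable => k _; exact: mB.
    - by rewrite setI_bigcupl.
  (* If the interval at [q k] meets [[-t, t]], then [|q k| <= 2 * t] because its radius is at most
     [|q k| / 16]. Its length [|q k| / 8 / 2 ^ k] is then at most this term, and the terms add up to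
     [t / 2]. *)
  apply: (@le_trans _ _ (\sum_(0 <= k <oo) (t / 2 / (2 ^ k.+1)%:R)%R%:E)%E); last first.
    by apply: epsilon_trick0; rewrite divr_ge0.
  apply: lee_nneseries => // k _.
  have [[s [sB sJ]]|/set0P/negP/negPn/eqP->] :=
    pselect (ball (q k) (e k) `&` J !=set0); last first.
    by rewrite measure0 lee_fin !divr_ge0.
  apply: (@le_trans _ _ (mu (ball (q k) (e k)))).
    apply: le_measure; rewrite ?inE; last exact: subIsetl; last exact: mB.
    exact: (measurableI _ _ (mB k) mJ).
  rewrite lebesgue_measure_ball// lee_fin.
  have qt : `|q k| <= 2 * t.
    have /= st := Jt _ sJ; move: sB; rewrite /ball/= => sB.
    have := ler_norm (q k); have := eq k.
    have := ler_normD (q k - s) s; rewrite subrK; lra.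
  rewrite expnS natrM invfM mulrA -mulrnAl -mulr_natr.
  by rewrite ler_wpM2r ?invr_ge0//; lra.
Qed.

(** [K] is [[-1, 1]] minus the sparse open set. That set covers at most half of an interval of
    length [t] adjacent to 0, so at least half is left to [K], on either side. *)
Lemma fat_cantor : exists K : set R,
  [/\ closed K,
      K `<=` `[-1, 1],
      forall x e : R, 0 < e -> exists2 y, ~ K y & `|x - y| < e,
      forall t : R, 0 <= t <= 1 -> ((t / 2)%:E <= mu (K `&` `]0%R, t]))%E &
      forall t : R, 0 <= t <= 1 -> ((t / 2)%:E <= mu (K `&` `](- t)%R, 0%R]))%E].
Proof.
have [U [oU dU mU]] := sparse_open_dense.
have mUU : measurable U by exact: open_measurable.
pose K : set R := `[-1, 1] `&` ~` U.
have key (a b : R) (t : R) : a <= b -> b - a = t -> -t <= a -> b <= t -> t <= 1 ->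
    ((t / 2)%:E <= mu (K `&` `]a, b]))%E.
  move=> ab bat ta tb t1.
  have mK : measurable K.
    by apply: measurableI => //; exact: measurableC.
  have t0 : 0 <= t by lra.
  have : (mu `]a, b] <= mu (U `&` `]a, b]) + mu (K `&` `]a, b]))%E.
    apply: le_trans (measureU2 _ _ _); [|exact: measurableI..].
    apply: le_measure; rewrite ?inE//; first by apply: measurableU; exact: measurableI.
    move=> x xab; have [Ux|Ux] := pselect (U x); [by left|right].
    split => //; split => //.
    by move: xab; rewrite /= !in_itv/= => /andP[? ?]; apply/andP; split; lra.
  rewrite lebesgue_measure_itv/= lte_fin.
  have -> : (if (a < b)%R then b%:E + (- a)%:E else 0%R)%E = t%:E.
    by case: ltP => ?; rewrite -?EFinD; congr EFin; lra.
  have UI : (mu (U `&` `]a, b]) <= (t / 2)%:E)%E.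
    apply: mU => // x; rewrite /= in_itv/= => /andP[? ?].
    by rewrite ler_norml; apply/andP; split; lra.
  move=> /le_trans /(_ (leeD2r _ UI)).
  rewrite -leeBlDl// => /(le_trans _); apply.
  by rewrite -EFinB lee_fin; lra.
exists K; split.
- by apply: closedI; [exact: itv_closed|exact: open_closedC].
- by move=> x [].
- move=> x e /(dU x)[y Uy xy]; exists y => // -[_]; exact.
- by move=> t /andP[t0 t1]; apply: key => //; lra.
- by move=> t /andP[t0 t1]; apply: key => //; lra.
Qed.

(** Vanishing to the left of [a] makes [m] integrable on every ray []-oo, x]], so a single integral
    from [-oo] serves at all points. *)
Lemma antiderivative_bounded_support (m : R -> R) (a B : R) :
  continuous m -> (forall x, `|m x| <= B) -> (forall x, x < a -> m x = 0) ->
  exists A : R -> R, forall x, is_derive x (1 : R) A (m x).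
Proof.
move=> cm mB m0.
have mm D : measurable D -> measurable_fun D m.
  by move=> mD; apply: measurable_funTS; exact: continuous_measurable_fun.
have im u : mu.-integrable `]-oo, u] (EFin \o m).
  have h : mu.-integrable (`]-oo, u] `&` `[a, +oo[) (EFin \o m).
    rewrite (_ : _ `&` _ = `[a, u]%classic); last first.
      apply/seteqP; split => x /=; rewrite !in_itv/= andbT; first by case=> -> ->.
      by move=> /andP[].
    apply: measurable_bounded_integrable => //.
    - by rewrite /= lebesgue_measure_itv/=; case: ifP => // _; rewrite ltry.
    - exact: mm.
    - by exists B; split; [exact: num_real|move=> x Bx y _ /=; rewrite (le_trans (mB y))// ltW].
  have {}h : mu.-integrable `]-oo, u] ((EFin \o m) \_ `[a, +oo[).
    by apply/integrable_restrict.
  apply: eq_integrable h => //.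
  move=> x _; rewrite patchE; case: ifPn => //; rewrite notin_setE/= in_itv/= andbT.
  by move=> /negP; rewrite -ltNge => /m0 ->.
exists (fun x => \int[mu]_(t in `]-oo, x]) m t) => x.
have [||||d1 d2] := @continuous_FTC1 R m -oo%O x (x + 1).
- by rewrite ltrDl.
- exact: im.
- by rewrite ltNyr.
- exact: cm.
- by rewrite -d2 derive1E; apply: DeriveDef.
Qed.

Lemma lipschitz1_continuous (f : R -> R) (L : R) :
  (forall x y, `|f x - f y| <= L * `|x - y|) -> continuous f.
Proof.
move=> fL x; apply/cvgrPdist_le => /= e e0.
near=> y.
apply: le_trans (fL x y) _.
have h : `|x - y| <= e / (`|L| + 1).
  near: y; apply: cvgr_dist_le; first exact: cvg_id.
  by rewrite divr_gt0// ltr_pwDr.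
apply: (@le_trans _ _ ((`|L| + 1) * `|x - y|)).
  by rewrite ler_wpM2r// (le_trans (ler_norm _))// lerDl.
by rewrite mulrC -ler_pdivlMr// ltr_pwDr.
Unshelve. all: by end_near. Qed.

Lemma continuous_of_is_derive (f df : R -> R) :
  (forall x, is_derive x (1 : R) f (df x)) -> continuous f.
Proof. by move=> h x; apply: differentiable_continuous; apply/derivable1_diffP. Qed.

Lemma is_derive_mvt (f df : R -> R) a b : (forall x, is_derive x (1 : R) f (df x)) ->
  a <= b -> exists2 c, a <= c <= b & f b - f a = df c * (b - a).
Proof.
move=> h ab.
have [|c] := @MVT_segment R f df a b ab (fun x _ => h x).
  by apply: continuous_subspaceT; exact: continuous_of_is_derive h.
by rewrite in_itv/=; exists c.
Qed.

(** [m] is the distribution function of Lebesgue measure restricted to [K]. Its increments show it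
    to be nondecreasing, 1-Lipschitz and constant on intervals that miss [K]; the bound 2 is the
    length of [[-1, 1]]. *)
Lemma cumulative_measure (K : set R) :
  closed K -> K `<=` `[-1, 1] ->
  exists m : R -> R,
  [/\ forall s t : R, s <= t -> (m t - m s)%:E = mu (K `&` `]s, t]),
      forall t : R, 0 <= m t <= 2 & forall t : R, t < -1 -> m t = 0].
Proof.
move=> cK K1.
have mK : measurable K by exact: closed_measurable.
have le2 (A : set R) : measurable A -> (mu (K `&` A) <= 2%:E)%E.
  move=> mA; apply: (@le_trans _ _ (mu `[-1, 1])).
    apply: le_measure; rewrite ?inE.
    - exact: (measurableI _ _ mK mA).
    - exact: measurable_itv.
    - by move=> x [/K1].
  rewrite lebesgue_measure_itv/= lte_fin ifT; last by lra.
  by rewrite -EFinD lee_fin; lra.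
have fin (A : set R) : measurable A -> mu (K `&` A) \is a fin_num.
  move=> mA; rewrite ge0_fin_numE//.
  by rewrite (le_lt_trans (le2 _ mA))// ltry.
pose m (t : R) := fine (mu (K `&` `]-oo, t])); exists m; split.
- move=> s t st.
  have -> : K `&` `]s, t] = (K `&` `]-oo, t]) `\` (K `&` `]-oo, s]).
    apply/seteqP; split => x /=; rewrite !in_itv/=.
      by move=> [Kx /andP[sx xt]]; split => // -[_]; rewrite leNgt sx.
    move=> [[Kx xt] h]; split => //; rewrite xt andbT ltNge; apply/negP => xs.
    exact: h.
  rewrite measureD.
  - rewrite /m EFinB !fineK; [|exact: fin (measurable_itv _)..].
    congr (_ - mu _)%E; apply/seteqP; split => x /=; rewrite !in_itv/=.
      by move=> [Kx xs]; split => //; split => //; exact: le_trans st.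
    by case.
  - exact: (measurableI _ _ mK (measurable_itv _)).
  - exact: (measurableI _ _ mK (measurable_itv _)).
  - by rewrite -ge0_fin_numE//; exact: fin (measurable_itv _).
- move=> t; rewrite fine_ge0//=.
  by rewrite -lee_fin fineK ?le2//; exact: fin (measurable_itv _).
- move=> t t1; rewrite /m (_ : _ `&` _ = set0) ?measure0//.
  apply/seteqP; split => // x /= [/K1 /=]; rewrite !in_itv/= => /andP[? ?] ?; lra.
Qed.

(* psi' = g = 8 * lambda (K `&` [0, t]) (signed), where K is the complement in
   [-1, 1] of a sparse dense open set. *)
Lemma wiggly_profile : exists (K : set R) (psi g : R -> R),
  [/\ closed K, forall x e : R, 0 < e -> exists2 y : R, ~ K y & `|x - y| < e,
     forall x : R, is_derive x (1 : R) psi (g x),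
     [/\ forall x y : R, `|g x - g y| <= 8 * `|x - y|,
         forall x, `|g x| <= 16 &
         forall x, ~ K x -> \forall y \near x, g y = g x] &
     [/\ psi 0 = 0, forall x, 0 <= psi x &
         forall x : R, `|x| <= 1 -> 2 * x ^+ 2 <= psi x]].
Proof.
have [K [cK K1 dK Kpos Kneg]] := fat_cantor.
have mK : measurable K by exact: closed_measurable.
have [m [mE m2 m0]] := cumulative_measure _ cK K1.
have m_incr s t : s <= t -> 0 <= m t - m s.
  by move=> st; rewrite -lee_fin mE.
have m_lip s t : s <= t -> m t - m s <= t - s.
  move=> st; rewrite -lee_fin mE//.
  apply: (@le_trans _ _ (mu `]s, t])).
    apply: le_measure; rewrite ?inE; [|exact: measurable_itv|exact: subIsetr].
    exact: (measurableI _ _ mK (measurable_itv _)).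
  rewrite lebesgue_measure_itv/= lte_fin.
  by case: ltP => ?; rewrite -?EFinD lee_fin; lra.
have m_const s t : s <= t -> (forall x, s < x <= t -> ~ K x) -> m t = m s.
  move=> st h; apply/eqP; rewrite -subr_eq0 -eqe mE//.
  rewrite (_ : _ `&` _ = set0) ?measure0//.
  by apply/seteqP; split => // x /= [Kx]; rewrite in_itv/= => /h.
have m_abs x y : `|m x - m y| <= `|x - y|.
  wlog xy : x y / x <= y => [h|].
    by case: (leP x y) => [/h//|/ltW/h]; rewrite distrC [`|x - y|]distrC.
  rewrite distrC [`|x - y|]distrC !ger0_norm ?subr_ge0//; first exact: m_lip.
  by rewrite -subr_ge0; exact: m_incr.
have [A AE] : exists A : R -> R, forall x, is_derive x (1 : R) A (m x).
  apply: (@antiderivative_bounded_support m (-1) 2).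
  - by apply: (@lipschitz1_continuous m 1) => x y; rewrite mul1r.
  - by move=> x; have /andP[? ?] := m2 x; rewrite ger0_norm.
  - exact: m0.
(* The factor 8 turns [x / 2 <= m x - m 0] into [4 * x <= g x] on [[0, 1]], where [4 * x] is the
   derivative of the desired lower bound [2 * x ^+ 2]. *)
pose g x := 8 * (m x - m 0).
pose psi x := 8 * (A x - A 0 - m 0 * x).
have psiE x : is_derive x (1 : R) psi (g x).
  rewrite /psi /g; apply: is_derive_eq.
  by rewrite /GRing.scale/= !mulr1; ring.
have psi0 : psi 0 = 0 by rewrite /psi; ring.
have m_0pos x : 0 <= x <= 1 -> x / 2 <= m x - m 0.
  move=> x01; rewrite -lee_fin mE; first exact: Kpos.
  by case/andP: x01.
have m_0neg x : 0 <= x <= 1 -> x / 2 <= m 0 - m (- x).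
  move=> x01; rewrite -lee_fin mE; first exact: Kneg.
  by case/andP: x01 => ? ?; lra.
exists K, psi, g; split => //; split => //.
- move=> x y; rewrite /g -mulrBr normrM opprB addrA subrK.
  by rewrite ger0_norm// ler_wpM2l.
- move=> x; rewrite /g normrM ger0_norm// [leRHS](_ : _ = 8 * 2) ?ler_wpM2l//; last by ring.
  have /andP[? ?] := m2 x; have /andP[? ?] := m2 0.
  by rewrite ler_norml; apply/andP; split; lra.
- move=> x Kx.
  have : nbhs x (~` K) by apply: open_nbhs_nbhs; split => //; exact: closed_openC.
  rewrite -nbhs_ballE => -[e /= e0 eK]; exists e => //= y xy.
  have away z : Order.min x y < z <= Order.max x y -> ~ K z.
    move=> h; apply: eK; move: h xy; rewrite /ball_/ball/= gt_min le_max.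
    by move=> /andP[/orP[] ? /orP[] ?]; rewrite !ltr_norml => /andP[? ?]; apply/andP; split; lra.
  rewrite /g; congr (_ * (_ - _)).
  by case: (leP x y) away => xy' away; [|symmetry]; apply: m_const => //; exact: ltW.
(* As [m] is nondecreasing, [g] has the sign of its argument; the mean value theorem is applied
   between 0 and [x]. *)
- move=> x; have [x0|x0] := leP 0 x.
    have [c /andP[c0 cx] E] := is_derive_mvt _ _ 0 x psiE x0.
    move: E; rewrite psi0 !subr0 => ->; rewrite mulr_ge0// mulr_ge0//.
    exact: m_incr.
  have [c /andP[c0 cx] E] := is_derive_mvt _ _ x 0 psiE (ltW x0).
  move: E; rewrite psi0 => E; have -> : psi x = (- g c) * (0 - x) by rewrite mulNr -E; lra.
  rewrite mulr_ge0//; last by lra.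
  by rewrite /g; have := m_incr _ _ cx; lra.
- pose h x := psi x - 2 * x ^+ 2.
  have hE x : is_derive x (1 : R) h (g x - 4 * x).
    rewrite /h; apply: is_derive_eq.
    by rewrite /GRing.scale/= !mulr1; ring.
  have h0 : h 0 = 0 by rewrite /h psi0; ring.
  move=> x; rewrite ler_norml => /andP[x1 x2]; rewrite -subr_ge0 -/(h x).
  have [x0|x0] := leP 0 x.
    have [c /andP[c0 cx] E] := is_derive_mvt _ _ 0 x hE x0.
    move: E; rewrite h0 !subr0 => ->; rewrite mulr_ge0//.
    have := m_0pos c; rewrite /g => H; have := H ltac:(lra); lra.
  have [c /andP[c0 cx] E] := is_derive_mvt _ _ x 0 hE (ltW x0).
  move: E; rewrite h0 => E.
  have -> : h x = (4 * c - g c) * (0 - x) by rewrite -opprB mulNr -E; lra.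
  rewrite mulr_ge0//; last by lra.
  have := m_0neg (- c); rewrite opprK /g => H; have := H ltac:(lra); lra.
Qed.

End RealLine.

(** * Real coordinates of C^n *)

Section Coordinates.
Context {R : realType} {n : nat}.
Implicit Types (p q : Cn R n) (b : bool) (j k : 'I_n) (F : R -> R).

Definition coord b j p : R :=
  if b then complex.Im (p 0 j) else complex.Re (p 0 j).

Lemma coordD b j p q : coord b j (p + q) = coord b j p + coord b j q.
Proof. by rewrite /coord mxE; case: (p 0 j) (q 0 j) => ? ? [? ?]; case: b. Qed.

Lemma coordN b j p : coord b j (- p) = - coord b j p.
Proof. by rewrite /coord mxE; case: (p 0 j) => ? ?; case: b. Qed.

Lemma coordB b j p q : coord b j (p - q) = coord b j p - coord b j q.
Proof. by rewrite coordD coordN. Qed.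

Lemma coord0 b j : coord b j 0 = 0.
Proof. by rewrite /coord mxE; case: b. Qed.

Lemma coordZ b j p (t : R) : coord b j ((t%:C)%C *: p) = t * coord b j p.
Proof.
rewrite /coord mxE; case: (p 0 j) => x y /=.
by case: b; rewrite /= mul0r ?addr0 ?subr0.
Qed.

Lemma coord_line b k j b' p (t : R) :
  coord b k (p + (t%:C)%C *: coord_dir b' j) =
  coord b k p + (if (b, k) == (b', j) then t else 0).
Proof.
rewrite coordD coordZ /coord_dir /coord !mxE eqxx/= xpair_eqE eq_sym.
case: (j == k) => /=; rewrite ?mulr1 ?mulr0; case: b; case: b' => /=;
by rewrite ?(mulr1, mulr0, mul0r, subr0, addr0, mul1r, mul0r).
Qed.

Lemma Re_normE (z : R[i]) :
  complex.Re `|z| = Num.sqrt (complex.Re z ^+ 2 + complex.Im z ^+ 2).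
Proof. by rewrite normc_def. Qed.

Lemma Re_le (x y : R[i]) : x <= y -> complex.Re x <= complex.Re y.
Proof. by rewrite lecE => /andP[]. Qed.

Lemma coord_le_norm b j p : `|coord b j p| <= complex.Re `|p|.
Proof.
have h : `|p 0 j| <= `|p|.
  rewrite -[`|p|]/(mx_norm p) mx_normE -[leLHS]nngE num_le.
  by apply: (le_bigmax _ _ (0, j)).
apply: le_trans (Re_le _ _ h); rewrite Re_normE -sqrtr_sqr ler_wsqrtr// /coord.
by case: b; rewrite ?lerDl ?lerDr sqr_ge0.
Qed.

(** The sharp factor would be the square root of 2; the cruder 2 keeps the constants rational. *)
Lemma norm_le_coord p (e : R) :
  0 <= e -> (forall b j, `|coord b j p| <= e) -> complex.Re `|p| <= 2 * e.
Proof.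
move=> e0 h; rewrite -[`|p|]/(mx_norm p).
have [->|/mx_norm_neq0[[i j] ->]] := eqVneq (mx_norm p) 0; first by rewrite mulr_ge0.
rewrite /= (ord1 i) [leLHS](Re_normE (p 0 j)) -[leRHS]ger0_norm ?mulr_ge0// -sqrtr_sqr ler_wsqrtr//.
have := h false j; have := h true j; rewrite /coord => hI hR.
rewrite -[X in X + _]real_normK ?num_real// -[X in _ + X]real_normK ?num_real//.
have : `|complex.Re (p 0 j)| ^+ 2 <= e ^+ 2 by rewrite ler_sqr ?nnegrE.
have : `|complex.Im (p 0 j)| ^+ 2 <= e ^+ 2 by rewrite ler_sqr ?nnegrE.
by rewrite exprMn; have := sqr_ge0 e; lra.
Qed.

Lemma ltc_norm_real p (e : R) : (`|p| < (e%:C)%C) = (complex.Re `|p| < e).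
Proof.
rewrite ltcE/=; have /ger0_Im -> := normr_ge0 p.
by rewrite eqxx.
Qed.

(** The norm takes values in [R[i]], so balls have complex radii. This trades them for real radii
    and real coordinates, in which the topological arguments below are carried out. *)
Lemma nbhs_coord p (A : set (Cn R n)) :
  nbhs p A <-> exists2 e : R, 0 < e & forall q, (forall b j, `|coord b j p - coord b j q| < e) -> A q.
Proof.
split.
  move=> /nbhs_normP[e /= e0 eA].
  have eE : e = ((complex.Re e)%:C)%C by rewrite RRe_real// gtr0_real.
  have e0' : 0 < complex.Re e by move: e0; rewrite {1}eE ltcR.
  (* Dividing by 3 keeps the inequality strict after the factor 2 of [norm_le_coord]. *)
  exists (complex.Re e / 3); first by rewrite divr_gt0.
  move=> q h; apply: eA; rewrite /ball_/= eE ltc_norm_real.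
  apply: (@le_lt_trans _ _ (2 * (complex.Re e / 3))); last by lra.
  by apply: norm_le_coord => [|b j]; [lra|rewrite coordB ltW].
move=> [e e0 eA]; apply/(@nbhs_normP _ _ p A); exists (e%:C)%C; first by rewrite /= ltcR.
move=> q; rewrite /ball_/= ltc_norm_real => h.
by apply: eA => b j; rewrite -coordB (le_lt_trans _ h)// coord_le_norm.
Qed.

Lemma continuous_coord b j : continuous (coord b j).
Proof.
move=> p A /nbhs_normP[e /= e0 eA].
by apply/nbhs_coord; exists e => // q h; apply: eA; exact: h.
Qed.

Lemma cvg_coord (T : Type) (S : set_system T) (FS : Filter S) (u : T -> Cn R n) p :
  (forall b j, coord b j (u x) @[x --> S] --> coord b j p) -> u x @[x --> S] --> p.
Proof.
move=> h A /nbhs_coord[e e0 eA].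
have : \forall x \near S, forall b j, `|coord b j p - coord b j (u x)| < e.
  have h1 b j : \forall x \near S, `|coord b j p - coord b j (u x)| < e.
    by have /cvgrPdist_lt := h b j; apply.
  have h2 b : \forall x \near S, forall j, `|coord b j p - coord b j (u x)| < e.
    by apply: filter_forall.
  apply: filterS2 (h2 true) (h2 false) => x ht hf [] j; [exact: ht|exact: hf].
by apply: filterS => x; exact: eA.
Qed.

Lemma along_coord F b k b' j p :
  along (fun q => F (coord b k q)) b' j p =
  fun t => F (coord b k p + (if (b, k) == (b', j) then t else 0)).
Proof. by apply/funext => t; rewrite /along coord_line. Qed.

(** Equality of the difference quotients themselves transfers both derivability and the value of the
    derivative. *)
Lemma shift_quotient F (c : R) :
  (fun h : R => h^-1 *: (((fun t => F (c + t)) \o shift 0) (h *: (1 : R)) - F (c + 0))) =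
  (fun h : R => h^-1 *: ((F \o shift c) (h *: (1 : R)) - F c)).
Proof. by apply/funext => h; rewrite /shift/= !addr0 (addrC c). Qed.

Lemma derive1_shift F (c : R) : derive1 (fun t : R => F (c + t)) 0 = derive1 F c.
Proof. by rewrite !derive1E /derive shift_quotient. Qed.

Lemma derivable_shift F (c : R) :
  derivable F c (1 : R) -> derivable (fun t : R => F (c + t)) 0 (1 : R).
Proof. by rewrite /derivable shift_quotient. Qed.

Lemma partial_coord F b k b' j p :
  partial b' j (fun q => F (coord b k q)) p =
  if (b, k) == (b', j) then derive1 F (coord b k p) else 0.
Proof.
rewrite /partial along_coord; case: ifP => _; first exact: derive1_shift.
by rewrite derive1_cst.
Qed.

Lemma derivable_along_coord F b k b' j p : derivable F (coord b k p) (1 : R) ->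
  derivable (along (fun q => F (coord b k q)) b' j p) 0 (1 : R).
Proof.
move=> h; rewrite along_coord; case: (_ == _); first exact: derivable_shift.
exact: derivable_cst.
Qed.

End Coordinates.

(** * Functions separable in real coordinates *)

Section Separable.
Context {R : realType} {n : nat}.
Implicit Types (p q w : Cn R n) (b : bool) (j k : 'I_n).
Variables (h dh : 'I_n -> R -> R) (M : R).
Hypothesis hE : forall j x, is_derive x (1 : R) (h j) (dh j x).
Hypothesis cdh : forall j, continuous (dh j).

(** The real and imaginary parts of [z_j] share the function [h j]. Where its second derivative is 2
    at both, the diagonal Levi coefficient is [(2 + 2) / 4 = 1]. *)
Definition sepfun p : R := \sum_(c : bool * 'I_n) h c.2 (coord c.1 c.2 p) - M.

Lemma along_sepfun b j p :
  along sepfun b j p =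
  (fun t => h j (coord b j p + t)) \+ cst (sepfun p - h j (coord b j p)).
Proof.
apply/funext => t; rewrite /along /sepfun/= !(bigD1 (b, j) (erefl true))/=.
rewrite coord_line eqxx.
under eq_bigr => c /negbTE cj do rewrite coord_line -surjective_pairing cj addr0.
ring.
Qed.

Lemma is_derive_shift j c : is_derive 0 (1 : R) (fun t => h j (c + t)) (dh j c).
Proof.
apply: DeriveDef; first by apply: derivable_shift; have [] := hE j c.
by rewrite -derive1E derive1_shift derive1E (@derive_val _ _ _ _ _ _ _ (hE j c)).
Qed.

Lemma derivable_along_sepfun b j p : derivable (along sepfun b j p) 0 (1 : R).
Proof.
rewrite along_sepfun; apply: derivableD; last exact: derivable_cst.
exact: derivable_shift.
Qed.

Lemma partial_sepfun b j : partial b j sepfun = fun p => dh j (coord b j p).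
Proof.
apply/funext => p; rewrite /partial along_sepfun derive1E.
have H := is_derive_shift j (coord b j p).
have C := is_derive_cst (sepfun p - h j (coord b j p)) (0 : R) (1 : R).
by rewrite (@derive_val _ _ _ _ _ _ _ (is_deriveD H C)) addr0.
Qed.

Lemma C1_sepfun U : C1_on U sepfun.
Proof.
split=> b j p _; first exact: derivable_along_sepfun.
rewrite partial_sepfun; apply: continuous_comp; first exact: continuous_coord.
exact: cdh.
Qed.

Lemma C11_sepfun U (L : R) : 0 <= L ->
  (forall j x y, `|dh j x - dh j y| <= L * `|x - y|) -> C11_on U sepfun.
Proof.
move=> L0 Ldh; split; first exact: C1_sepfun.
move=> b j; exists L => p q _ _; rewrite partial_sepfun.
by rewrite (le_trans (Ldh _ _ _))// ler_wpM2l// -coordB coord_le_norm.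
Qed.

Section SecondOrder.
Variable U : set (Cn R n).
Hypothesis oU : open U.
Hypothesis ddh : forall p b j, U p -> is_derive (coord b j p) (1 : R) (dh j) 2.

(** On [U] each second partial is constantly 2 or 0, so its continuity follows from the openness of
    [U]. *)
Lemma C2_sepfun : C2_on U sepfun.
Proof.
split; first exact: C1_sepfun.
move=> b j; rewrite partial_sepfun; split=> b' j' p Up.
  by apply: derivable_along_coord; have [] := ddh _ b j Up.
have E q : U q -> partial b' j' (fun q => dh j (coord b j q)) q =
    (if (b, j) == (b', j') then 2 else 0).
  by move=> Uq; rewrite partial_coord derive1E; have /@derive_val -> := ddh _ b j Uq.
move=> A /nbhs_singleton; rewrite (E _ Up) => cA.
have : nbhs p U by apply: open_nbhs_nbhs; split.
by apply: filterS => q /E qE; rewrite /= qE.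
Qed.

Lemma invC2 : (2^-1 : R[i]) = ((2^-1)%:C)%C.
Proof. by rewrite fmorphV rmorph_nat. Qed.

Lemma partial_cst0 b j p : partial b j (fun=> 0 : R) p = 0.
Proof. by rewrite /partial /along derive1_cst. Qed.

Lemma dzbar_sepfun k : dzbar k (fun z => ((sepfun z)%:C)%C) =
  fun p => (dh k (coord false k p) / 2 +i* (dh k (coord true k p) / 2))%C.
Proof.
apply/funext => p; rewrite /dzbar /cpartial/= !partial_cst0 !partial_sepfun invC2.
apply/eqP; rewrite eq_complex/=; apply/andP; split; apply/eqP; ring.
Qed.

Lemma dz_dzbar_sepfun j k p : U p ->
  dz j (dzbar k (fun z => ((sepfun z)%:C)%C)) p = (j == k)%:R.
Proof.
move=> Up; rewrite dzbar_sepfun /dz /cpartial/=.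
have E b b' : partial b j (fun z => dh k (coord b' k z) / 2) p = ((b' == b) && (k == j))%:R.
  rewrite (partial_coord (fun x => dh k x / 2)) xpair_eqE; case: ifP => // _.
  have D := ddh _ b' k Up.
  rewrite derive1E; have -> : (fun x => dh k x / 2) = 2^-1 *: dh k.
    by apply/funext => x /=; rewrite mulrC.
  by rewrite deriveZ// derive_val /GRing.scale/= mulVf.
rewrite !(E _ false) !(E _ true)/= invC2 eq_sym.
apply/eqP; rewrite eq_complex; case: (j == k) => /=; apply/andP; split; apply/eqP; lra.
Qed.

(** The Levi matrix is the identity, so the form is the squared Euclidean norm of [w]. *)
Lemma levi_sepfun p w : U p -> w != 0 ->
  0 < complex.Re (levi_form sepfun p w).
Proof.
move=> Up w0; rewrite /levi_form.
have -> : \sum_j \sum_k dz j (dzbar k (fun z => ((sepfun z)%:C)%C)) p *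
     w 0 j * conjc (w 0 k) = \sum_j \sum_k (j == k)%:R * w 0 j * conjc (w 0 k).
  by apply: eq_bigr => j _; apply: eq_bigr => k _; rewrite (dz_dzbar_sepfun _ _ _ Up).
have -> : \sum_j \sum_k (j == k)%:R * w 0 j * conjc (w 0 k) = \sum_j (((coord false j w) ^+ 2 + (coord true j w) ^+ 2)%:C)%C.
  apply: eq_bigr => j _; rewrite (bigD1 j)//= eqxx mul1r.
  rewrite big1 ?addr0 => [|k kj].
    by rewrite /coord; case: (w 0 j) => x y; apply/eqP; rewrite eq_complex/=;
      apply/andP; split; apply/eqP; ring.
  by rewrite eq_sym (negbTE kj) !mul0r.
rewrite -rmorph_sum/=.
have [j wj] : exists j, w 0 j != 0.
  apply/existsP; apply: contra_neqT w0 => /existsPn H.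
  by apply/rowP => j; rewrite mxE; apply/eqP; rewrite -[_ == _]negbK; exact: H.
rewrite (bigD1 j)//= ltr_wpDr//; first by apply: sumr_ge0 => i _; rewrite addr_ge0// sqr_ge0.
rewrite lt_neqAle addr_ge0 ?sqr_ge0// andbT eq_sym paddr_eq0 ?sqr_ge0// !sqrf_eq0.
by move: wj; rewrite eq_complex/=.
Qed.

End SecondOrder.
End Separable.

(** * Points of C^2 *)

Section ComplexPlane.
Context {R : realType}.
Implicit Types (x y t s : R).

Definition point4 x y u v : Cn R 2 :=
  \row_j (if j == ord0 then x +i* y else u +i* v)%C.

Lemma coord_point4 x y u v :
  [/\ coord false ord0 (point4 x y u v) = x, coord true ord0 (point4 x y u v) = y,
      coord false ord_max (point4 x y u v) = u & coord true ord_max (point4 x y u v) = v].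
Proof. by rewrite /coord !mxE. Qed.

Lemma ord2P (P : 'I_2 -> Prop) : P ord0 -> P ord_max -> forall j, P j.
Proof.
move=> P0 P1 [[|[|//]] lt_j].
  by rewrite (_ : Ordinal _ = ord0) //; exact: val_inj.
by rewrite (_ : Ordinal _ = ord_max) //; exact: val_inj.
Qed.

Lemma sum_bool_ord2 (F : bool * 'I_2 -> R) :
  \sum_c F c = F (false, ord0) + F (true, ord0) + F (false, ord_max) + F (true, ord_max).
Proof.
under eq_bigr do rewrite [X in F X]surjective_pairing.
rewrite -(pair_bigA _ (fun b j => F (b, j)))/= big_bool !big_ord_recl !big_ord0.
rewrite (_ : lift ord0 ord0 = ord_max :> 'I_2); last exact/val_inj.
by rewrite /=; ring.
Qed.

Lemma sepfunE (h : 'I_2 -> R -> R) M p : sepfun h M p =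
  h ord0 (coord false ord0 p) + h ord0 (coord true ord0 p) +
  h ord_max (coord false ord_max p) + h ord_max (coord true ord_max p) - M.
Proof. by rewrite /sepfun sum_bool_ord2. Qed.

Lemma continuous_sum_coord (F : bool -> 'I_2 -> R -> R) :
  (forall b j, continuous (F b j)) ->
  continuous (fun p : Cn R 2 => \sum_(c : bool * 'I_2) F c.1 c.2 (coord c.1 c.2 p)).
Proof.
move=> cF.
have c1 b j : continuous (fun p : Cn R 2 => F b j (coord b j p)).
  by move=> p; apply: continuous_comp; [exact: continuous_coord|exact: cF].
under eq_fun do rewrite sum_bool_ord2/=.
move=> p.
exact: (continuousD (continuousD (continuousD (c1 false ord0 p) (c1 true ord0 p))
   (c1 false ord_max p)) (c1 true ord_max p)).
Qed.

Lemma point4_near x y u v (p : Cn R 2) e :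
  `|coord false ord0 p - x| < e -> `|coord true ord0 p - y| < e ->
  `|coord false ord_max p - u| < e -> `|coord true ord_max p - v| < e ->
  forall b j, `|coord b j p - coord b j (point4 x y u v)| < e.
Proof.
have [E1 E2 E3 E4] := coord_point4 x y u v.
by move=> ? ? ? ? []; apply: ord2P; rewrite ?(E1, E2, E3, E4).
Qed.

Lemma point4_disc u v a b :
  point4 0 0 u v + (a +i* b)%C *: (point4 1 0 0 0 : Cn R 2) = point4 a b u v.
Proof.
apply/rowP => j; rewrite !mxE; case: ifP => _;
by apply/eqP; rewrite eq_complex/=; apply/andP; split; apply/eqP; ring.
Qed.

End ComplexPlane.

(** * The domain *)

Section WigglyDomain.
Context {R : realType}.
Variables (K : set R) (psi g : R -> R).
Hypothesis cK : closed K.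
Hypothesis dK : forall x e : R, 0 < e -> exists2 y : R, ~ K y & `|x - y| < e.
Hypothesis psiE : forall x : R, is_derive x (1 : R) psi (g x).
Hypothesis g_lip : forall x y : R, `|g x - g y| <= 8 * `|x - y|.
Hypothesis g_le : forall x, `|g x| <= 16.
Hypothesis g_loc : forall x, ~ K x -> \forall y \near x, g y = g x.
Hypothesis psi0 : psi 0 = 0.
Hypothesis psi_ge0 : forall x, 0 <= psi x.
Hypothesis psi_ge : forall x : R, `|x| <= 1 -> 2 * x ^+ 2 <= psi x.

(* On the z_1-plane the second derivative of the profile is 2 off K, although
   the profile is at most - t^2 on [-1, 1]. *)
Definition profile (j : 'I_2) (t : R) : R :=
  if j == ord0 then t ^+ 2 - psi t else t ^+ 2.
Definition dprofile (j : 'I_2) (t : R) : R :=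
  if j == ord0 then 2 * t - g t else 2 * t.

Lemma is_derive_profile j (x : R) : is_derive x (1 : R) (profile j) (dprofile j x).
Proof.
rewrite /profile /dprofile; case: (j == ord0).
  by apply: is_derive_eq; rewrite /GRing.scale/= !mulr1; ring.
by apply: is_derive_eq; rewrite /GRing.scale/= !mulr1; ring.
Qed.

Lemma dprofile_lip j (x y : R) : `|dprofile j x - dprofile j y| <= 10 * `|x - y|.
Proof.
have h : `|2 * x - 2 * y| <= 2 * `|x - y| by rewrite -mulrBr normrM ger0_norm.
rewrite /dprofile; case: ifP => _; last by have := normr_ge0 (x - y); lra.
rewrite (_ : _ - _ = (2 * x - 2 * y) - (g x - g y)); last by ring.
by have := ler_normB (2 * x - 2 * y) (g x - g y); have := g_lip x y; lra.
Qed.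

Lemma continuous_dprofile j : continuous (dprofile j).
Proof. exact: (lipschitz1_continuous _ 10 (dprofile_lip j)). Qed.

Lemma is_derive_dprofile j (x : R) : (j == ord0 -> ~ K x) -> is_derive x (1 : R) (dprofile j) 2.
Proof.
rewrite /dprofile; case: (j == ord0) => Kx.
  apply: (@near_eq_is_derive _ _ _ (fun t : R => 2 * t - g x)).
    by have := g_loc _ (Kx isT); apply: filterS => y ->.
  by apply: is_derive_eq; rewrite /GRing.scale/= !mulr1; ring.
by apply: is_derive_eq; rewrite /GRing.scale/= !mulr1; ring.
Qed.

Lemma psi_lip (x y : R) : `|psi x - psi y| <= 16 * `|x - y|.
Proof.
wlog xy : x y / y <= x => [H|].
  by case: (leP y x) => [/H//|/ltW/H]; rewrite distrC [`|x - y|]distrC.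
have [c _ ->] := is_derive_mvt _ _ _ _ psiE xy.
by rewrite normrM ler_wpM2r.
Qed.

Lemma profile_le j (x : R) : profile j x <= x ^+ 2.
Proof. by rewrite /profile; case: ifP => // _; rewrite gerBl. Qed.

(** Expanding the square of [|x| - 16]. The slope 16 is the Lipschitz constant of [psi], so the
    quadratic part of the profile absorbs [psi] up to 128 per real coordinate. *)
Lemma linear_le_square (x : R) : 16 * `|x| <= x ^+ 2 / 2 + 128.
Proof. by have := sqr_ge0 (`|x| - 16); rewrite sqrrB real_normK ?num_real//; lra. Qed.

(** The square contributes [(1 - s) * (1 + s) * x ^+ 2], and [psi] takes away at most
    [16 * (1 - s) * |x|]. *)
Lemma profile_ray j (x s : R) : 0 <= s <= 1 ->
  (1 - s) * (x ^+ 2 / 2 - 128) <= profile j x - profile j (s * x).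
Proof.
move=> /andP[s0 s1].
have e1 : 0 <= 1 - s by lra.
apply: (@le_trans _ _ ((1 - s) * ((1 + s) * x ^+ 2 - 16 * `|x|))).
  rewrite ler_wpM2l//; have := linear_le_square x; have := mulr_ge0 s0 (sqr_ge0 x); lra.
rewrite /profile; case: ifP => _.
  have := psi_lip x (s * x); rewrite -[X in X - s * x]mul1r -mulrBl normrM (ger0_norm e1).
  move=> h; have := le_trans (ler_norm _) h.
  by move=> ?; rewrite exprMn; lra.
by have := mulr_ge0 e1 (normr_ge0 x); rewrite exprMn; lra.
Qed.

Lemma profile_grad j (x : R) : 3 / 2 * x ^+ 2 - 128 <= x * dprofile j x.
Proof.
rewrite /dprofile; case: ifP => _; last by have := sqr_ge0 x; nra.
have := linear_le_square x.
have : x * g x <= 16 * `|x|.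
  by rewrite (le_trans (ler_norm _))// normrM mulrC ler_wpM2r.
rewrite mulrBr; nra.
Qed.

(** The level is [50 ^+ 2]. It is large enough that on [0 <= rho], where [sqnorm] is at least 2500,
    the total error [4 * 128 = 512] is dominated both along rays and in the radial derivative. *)
Definition rho : Cn R 2 -> R := sepfun profile 2500.

Definition Omega : set (Cn R 2) := [set p | rho p < 0].

Definition sqnorm (p : Cn R 2) : R := \sum_(c : bool * 'I_2) (coord c.1 c.2 p) ^+ 2.

Lemma continuous_rho : continuous rho.
Proof.
have H := @continuous_sum_coord R (fun b j => profile j)
  (fun b j => continuous_of_is_derive _ _ (is_derive_profile j)).
move=> p; exact: (continuousB (H p) (@cst_continuous _ _ (2500 : R) p)).
Qed.

Lemma rho_point4 x y u v : rho (point4 x y u v) = 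
  (x ^+ 2 - psi x) + (y ^+ 2 - psi y) + u ^+ 2 + v ^+ 2 - 2500.
Proof. by have [E1 E2 E3 E4] := coord_point4 x y u v; rewrite /rho sepfunE E1 E2 E3 E4. Qed.

Lemma sum_128 : \sum_(c : bool * 'I_2) (128 : R) = 512.
Proof. by rewrite sum_bool_ord2; ring. Qed.

Lemma rho_le p : rho p <= sqnorm p - 2500.
Proof. by rewrite /rho /sepfun lerD2r; apply: ler_sum => c _; exact: profile_le. Qed.

Lemma rho_ray p (s : R) : 0 <= s <= 1 -> (1 - s) * (sqnorm p / 2 - 512) <= rho p - rho ((s%:C)%C *: p).
Proof.
move=> s01; rewrite /rho /sepfun opprB addrA subrK -sumrB -sum_128 /sqnorm mulr_suml -sumrB mulr_sumr.
by apply: ler_sum => c _; rewrite coordZ; exact: profile_ray.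
Qed.

Lemma rho0 : rho 0 = - 2500.
Proof.
rewrite /rho sepfunE !coord0 /profile/= psi0; ring.
Qed.

Lemma sqnorm_le p : rho p <= 0 -> sqnorm p <= 6024.
Proof.
(* At [s = 0] the ray estimate compares with the origin: [sqnorm p / 2 - 512 <= rho p + 2500]. *)
move=> r0; have := @rho_ray p 0; rewrite lexx ler01 => /(_ isT).
by rewrite scale0r rho0; lra.
Qed.

Lemma coord_le100 p b j : rho p <= 0 -> `|coord b j p| <= 100.
Proof.
move=> /sqnorm_le; rewrite /sqnorm (bigD1 (b, j))//= => h.
have : 0 <= \sum_(c : bool * 'I_2 | c != (b, j)) (coord c.1 c.2 p) ^+ 2.
  by apply: sumr_ge0 => c _; exact: sqr_ge0.
move=> h2; rewrite -ler_sqr ?nnegrE// real_normK ?num_real//; lra.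
Qed.

(* Omega is star-shaped: wherever rho is nonnegative, the squared norm is at least
   2500 and rho increases along rays. *)
Lemma Omega_ray p (s : R) : 0 <= s < 1 -> rho p <= 0 -> Omega ((s%:C)%C *: p).
Proof.
move=> /andP[s0 s1] rp; rewrite /Omega/= ltNge; apply/negP => h.
have := rho_le ((s%:C)%C *: p).
have -> : sqnorm ((s%:C)%C *: p) = s ^+ 2 * sqnorm p.
  by rewrite /sqnorm mulr_sumr; apply: eq_bigr => c _; rewrite coordZ exprMn.
have Q0 : 0 <= sqnorm p by apply: sumr_ge0 => c _; exact: sqr_ge0.
have := @rho_ray p s; rewrite s0 (ltW s1) => /(_ isT).
have : s ^+ 2 * sqnorm p <= sqnorm p by rewrite ler_piMl// expr_le1// ltW.
have : 0 < 1 - s by lra.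
move=> ? ? ? ?; nra.
Qed.

(** * Transversality of the boundary to rays *)

(** The sum is the radial derivative of [rho]. Its positivity is an open condition that holds on the
    boundary and prevents the gradient from vanishing, so [rho] is a defining function there. *)
Definition transverse : set (Cn R 2) :=
  [set p | 0 < \sum_(c : bool * 'I_2) coord c.1 c.2 p * dprofile c.2 (coord c.1 c.2 p)].

Lemma open_transverse : open transverse.
Proof.
have c : continuous (fun p : Cn R 2 => \sum_(c : bool * 'I_2) coord c.1 c.2 p * dprofile c.2 (coord c.1 c.2 p)).
  apply: (@continuous_sum_coord R (fun b j x => x * dprofile j x)) => b j x.
  by apply: continuousM; [exact: cvg_id|exact: continuous_dprofile].
by move/continuousP : c => /(_ _ (@open_gt R 0)).
Qed.

(** Here [sqnorm p] is at least 2500, so the radial derivative is at least [3 / 2 * 2500 - 512]. *)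
Lemma rho_transverse p : 0 <= rho p -> transverse p.
Proof.
move=> r0; rewrite /transverse/=.
have : \sum_(c : bool * 'I_2) (3 / 2 * coord c.1 c.2 p ^+ 2 - 128) <=
    \sum_(c : bool * 'I_2) coord c.1 c.2 p * dprofile c.2 (coord c.1 c.2 p).
  by apply: ler_sum => c _; exact: profile_grad.
rewrite sumrB sum_128 -mulr_sumr -/(sqnorm p); have := rho_le p; lra.
Qed.

Lemma transverse_partial p : transverse p -> exists b j, partial b j rho p != 0.
Proof.
move=> Vp; have [[b j] h] : exists c : bool * 'I_2, dprofile c.2 (coord c.1 c.2 p) != 0.
  apply/existsP; apply/contraT; rewrite negb_exists => /forallP H.
  move: Vp; rewrite /transverse/= big1 ?ltxx// => c _.
  by have := H c; rewrite negbK => /eqP ->; rewrite mulr0.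
by exists b, j; rewrite /rho (partial_sepfun _ _ _ is_derive_profile).
Qed.

Lemma defining_rho U : open U -> U `<=` transverse -> local_defining Omega U rho.
Proof. by move=> oU UV; split => // z /UV /transverse_partial. Qed.

(** * Topology of the domain and its boundary *)

Lemma open_Omega : open Omega.
Proof. by move/continuousP : continuous_rho => /(_ _ (@open_lt R 0)). Qed.

Lemma closure_Omega p : closure Omega p -> rho p <= 0.
Proof.
have c : closed [set q | rho q <= 0].
  by move/continuous_closedP : continuous_rho => /(_ _ (@closed_le R 0)).
by move=> /(closure_subset (fun q (h : Omega q) => ltW h : [set q | rho q <= 0] q)) /c.
Qed.

Lemma Omega_near p (e : R) : rho p <= 0 -> 0 < e ->
  exists2 q, Omega q & forall b j, `|coord b j p - coord b j q| < e.
Proof.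
(* The point is scaled by [1 - d]. Its coordinates are at most 100 in absolute value, so
   [d <= e / 200] moves each by at most [e / 2]. *)
move=> rp e0; pose d := Order.min (1 / 2) (e / 200).
have d0 : 0 < d by rewrite lt_min; apply/andP; split; lra.
have d1 : d <= 1 / 2 by rewrite ge_min lexx.
have de : d <= e / 200 by rewrite ge_min lexx orbT.
exists (((1 - d)%:C)%C *: p).
  by apply: Omega_ray => //; apply/andP; split; lra.
move=> b j; rewrite coordZ -[X in X - _]mul1r -mulrBl normrM opprB addrC subrK.
rewrite (gtr0_norm d0); have := coord_le100 p b j rp; have := normr_ge0 (coord b j p); nra.
Qed.

(** Continuity of [rho] gives one direction. Conversely a zero of [rho] is approached from inside
    along its ray, by [Omega_near]. *)
Lemma boundary_rho p : boundary Omega p <-> rho p = 0.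
Proof.
rewrite /boundary (interior_id Omega).1; last exact: open_Omega.
split.
  move=> [/closure_Omega r0 /negP]; rewrite /Omega/= -leNgt => r1.
  by apply/eqP; rewrite eq_le r0.
move=> rp; split; last by rewrite /Omega/= rp ltxx.
move=> A /nbhs_coord[e e0 eA].
have [|q qO pq] := @Omega_near p e _ e0; first by rewrite rp.
by exists q; split => //; exact: eA.
Qed.

Lemma bounded_Omega : bounded_set Omega.
Proof.
exists ((200 : R)%:C)%C; split; first by rewrite ger0_real// ler0c.
move=> x x200 p /ltW pO; apply: le_trans (ltW x200).
rewrite lecE/=; have /ger0_Im -> := normr_ge0 p; rewrite eqxx/=.
rewrite (_ : 200 = 2 * 100 :> R); last by ring.
by apply: norm_le_coord => // b j; exact: coord_le100.
Qed.

Lemma Omega0 : Omega 0.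
Proof. by rewrite /Omega/= rho0; lra. Qed.

Lemma connected_Omega : connected Omega.
Proof.
(* By star-shapedness the domain is the union of the segments from 0 to its points. *)
pose seg p : set (Cn R 2) := [set ((s%:C)%C *: p : Cn R 2) | s in `[0, 1]].
have -> : Omega = \bigcup_(p in Omega) seg p.
  apply/seteqP; split.
    move=> p pO; exists p => //; exists 1; first by rewrite /= in_itv/= lexx ler01.
    by rewrite scale1r.
  move=> q [p pO [s /=]]; rewrite in_itv/= => /andP[s0 s1] <-.
  have [->|s1'] := eqVneq s 1; first by rewrite scale1r.
  by apply: Omega_ray (ltW pO); rewrite s0 lt_neqAle s1'.
apply: bigcup_connected.
  exists 0 => p _; exists 0; first by rewrite /= in_itv/= lexx ler01.
  by rewrite scale0r.
move=> p _; apply: connected_continuous_connected; first exact: segment_connected.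
apply: continuous_subspaceT => s; apply: cvg_coord => b j.
rewrite coordZ; under eq_fun do rewrite coordZ.
by apply: cvgM; [exact: cvg_id|exact: cvg_cst].
Qed.

Lemma C11_Omega : C11_smooth_boundary Omega.
Proof.
move=> p /boundary_rho rp; exists transverse, rho; split.
- by apply: rho_transverse; rewrite rp.
- by apply: defining_rho => //; exact: open_transverse.
- exact: (C11_sepfun _ _ 2500 is_derive_profile continuous_dprofile _ 10 _ dprofile_lip).
Qed.

(** * Strict pseudoconvexity off the exceptional set *)

Definition generic : set (Cn R 2) :=
  [set p | ~ K (coord false ord0 p) /\ ~ K (coord true ord0 p)].

Lemma open_generic : open generic.
Proof.
have oK : open (~` K) by exact: closed_openC.
have h b : open ((@coord R 2 b ord0) @^-1` (~` K)).
  by move/continuousP : (@continuous_coord R 2 b ord0); exact.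
exact: openI (h false) (h true).
Qed.

Lemma spc_Omega p : generic p -> boundary Omega p ->
  C2_smooth_at Omega p /\ exists U : set (Cn R 2), [/\ open U, U p &
    forall q, U q -> boundary Omega q -> strictly_pseudoconvex_at Omega q].
Proof.
move=> Gp /boundary_rho rp.
have oU : open (transverse `&` generic) by apply: openI; [exact: open_transverse|exact: open_generic].
have dd q b j : (transverse `&` generic) q -> is_derive (coord b j q) (1 : R) (dprofile j) 2.
  move=> [_ [G0 G1]]; apply: is_derive_dprofile; move=> /eqP ->.
  by case: b.
have C2 : C2_on (transverse `&` generic) rho.
  exact: (C2_sepfun _ _ 2500 is_derive_profile continuous_dprofile _ oU dd).
have Up : (transverse `&` generic) p by split => //; apply: rho_transverse; rewrite rp.
have D : local_defining Omega (transverse `&` generic) rho by apply: defining_rho => // ? [].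
split; first by exists (transverse `&` generic), rho.
exists (transverse `&` generic); split => // q Uq _; exists (transverse `&` generic), rho; split => // w w0 _.
exact: (levi_sepfun _ _ 2500 is_derive_profile _ dd _ _ Uq w0).
Qed.

(** * The exceptional set and density of its complement *)

Definition exceptional : set (Cn R 2) := boundary Omega `\` generic.

Lemma closed_exceptional : closed exceptional.
Proof.
apply: closedI; last by apply: open_closedC; exact: open_generic.
by apply: closedI; [exact: closed_closure|apply: open_closedC; exact: open_interior].
Qed.

(** Keeping the sign of [u] and taking the root of [u ^+ 2 + D], which is at most [|u|] plus the
    root of [D], bounds the displacement uniformly in [u]. *)
Lemma sqrt_shift (u D : R) : 0 <= D ->
  exists2 u', u' ^+ 2 = u ^+ 2 + D & `|u' - u| <= Num.sqrt D.
Proof.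
move=> D0; pose v := Num.sqrt (u ^+ 2 + D).
have v2 : v ^+ 2 = u ^+ 2 + D by rewrite sqr_sqrtr// addr_ge0// sqr_ge0.
have uv : `|u| <= v by rewrite -sqrtr_sqr ler_wsqrtr// lerDl.
have vu : v <= `|u| + Num.sqrt D.
  rewrite -ler_sqr ?nnegrE ?addr_ge0 ?sqrtr_ge0// v2 sqrrD real_normK ?num_real// sqr_sqrtr//.
  have : 0 <= `|u| * Num.sqrt D by rewrite mulr_ge0// sqrtr_ge0.
  lra.
have [u0|u0] := leP 0 u.
  exists v => //; rewrite (ger0_norm u0) in uv vu; rewrite ger0_norm; lra.
exists (- v); first by rewrite sqrrN.
rewrite (ltr0_norm u0) in uv vu; rewrite ler0_norm; lra.
Qed.

(* Push a boundary point inside along its ray, move x_1 and y_1 off K, and then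
   restore rho = 0 by increasing |Re z_2|, on which rho depends exactly
   quadratically. *)
Lemma dense_generic : boundary Omega `<=` closure (boundary Omega `\` exceptional).
Proof.
move=> p /boundary_rho rp A /nbhs_coord[e e0 eA].
(* The tolerance on [rho] is a square because the final correction of [Re z_2] has size at most the
   root of the defect [D]. *)
have [d d0 pd] : exists2 d : R, 0 < d & forall q, (forall b j, `|coord b j p - coord b j q| < d) ->
    `|rho q| < (e / 2) ^+ 2.
  apply/nbhs_coord.
  have /cvgrPdist_lt := @continuous_rho p.
  move=> /(_ ((e / 2) ^+ 2)); rewrite exprn_gt0 ?divr_gt0// => /(_ isT).
  by apply: filterS => q; rewrite rp sub0r normrN.
(* Two moves of size below [d'] stay within [d] of [p]; the correction by less than [e / 2] then
   stays within [e]. *)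
pose d' := Order.min (d / 2) (e / 4).
have d'0 : 0 < d' by rewrite lt_min; apply/andP; split; lra.
have d'd : d' <= d / 2 by rewrite ge_min lexx.
have d'e : d' <= e / 4 by rewrite ge_min lexx orbT.
have [|q Oq pq] := @Omega_near p d' _ d'0; first by rewrite rp.
have [f f0 qf] : exists2 f : R, 0 < f & forall r, (forall b j, `|coord b j q - coord b j r| < f) -> Omega r.
  by apply/nbhs_coord; apply: open_nbhs_nbhs; split => //; exact: open_Omega.
pose f' := Order.min f d'.
have f'0 : 0 < f' by rewrite lt_min f0.
have f'f : f' <= f by rewrite ge_min lexx.
have f'd : f' <= d' by rewrite ge_min lexx orbT.
have [x Kx qx] := dK (coord false ord0 q) _ f'0.
have [y Ky qy] := dK (coord true ord0 q) _ f'0.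
pose u := coord false ord_max q; pose v := coord true ord_max q.
have qr b j : `|coord b j q - coord b j (point4 x y u v)| < f'.
  by apply: point4_near => //; rewrite subrr normr0.
have pr b j : `|coord b j p - coord b j (point4 x y u v)| < 2 * d'.
  have := ler_distD (coord b j q) (coord b j p) (coord b j (point4 x y u v)).
  by have := pq b j; have := qr b j; lra.
have Or : Omega (point4 x y u v) by apply: qf => b j; rewrite (lt_le_trans (qr b j)).
have : `|rho (point4 x y u v)| < (e / 2) ^+ 2 by apply: pd => b j; have := pr b j; lra.
rewrite (ltr0_norm Or); set D := - rho _ => De.
have D0 : 0 < D by rewrite oppr_gt0.
have [u' u'2 uu'] := sqrt_shift u _ (ltW D0).
have De' : Num.sqrt D < e / 2.
  rewrite -[ltRHS]ger0_norm; last by lra.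
  by rewrite -sqrtr_sqr ltr_sqrt// exprn_gt0// divr_gt0.
exists (point4 x y u' v); split.
  have B : boundary Omega (point4 x y u' v).
    apply/boundary_rho; rewrite rho_point4 u'2.
    by move: (rho_point4 x y u v); rewrite -[rho _]opprK -/D; lra.
  split => // -[_]; apply.
  by have [E1 E2 _ _] := coord_point4 x y u' v; split; rewrite ?E1 ?E2.
apply: eA; apply: point4_near.
- by have [E1 _ _ _] := coord_point4 x y u v; have := pr false ord0; rewrite E1; lra.
- by have [_ E1 _ _] := coord_point4 x y u v; have := pr true ord0; rewrite E1; lra.
- have := ler_distD u (coord false ord_max p) u'.
  by have := pq false ord_max; rewrite -/u [`|u - u'|]distrC; lra.
- by have := pq true ord_max; rewrite -/v; lra.
Qed.

(** * Failure of pseudoconvexity *)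

Lemma profile_disc (x : R) : `|x| <= 1 -> x ^+ 2 - psi x <= - x ^+ 2.
Proof. by move=> /psi_ge; lra. Qed.

(** On the unit disc in [z_1] at height [s], [rho] is at most [s ^+ 2 - 2500 - |z_1| ^+ 2]. This
    admits whole closed discs for [0 <= s < 50], and at [s = 50] still the bounding circle. *)
Lemma disc_Omega x y s : x ^+ 2 + y ^+ 2 <= 1 -> 0 < (x ^+ 2 + y ^+ 2) + (2500 - s ^+ 2) ->
  Omega (point4 x y s 0).
Proof.
move=> xy h; rewrite /Omega/= rho_point4.
have x1 : `|x| <= 1.
  by rewrite -ler_sqr ?nnegrE// real_normK ?num_real// expr1n; have := sqr_ge0 y; lra.
have y1 : `|y| <= 1.
  by rewrite -ler_sqr ?nnegrE// real_normK ?num_real// expr1n; have := sqr_ge0 x; lra.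
by have := profile_disc _ x1; have := profile_disc _ y1; rewrite expr0n/=; lra.
Qed.

Lemma continuous_circle_point4 : continuous (fun a : (R * R)%type => point4 (cos a.1) (sin a.1) a.2 0).
Proof.
move=> a; apply: cvg_coord.
have c1 : continuous (fun a : (R * R)%type => cos a.1).
  by move=> {}a; apply: continuous_comp; [exact: cvg_fst|exact: continuous_cos].
have c2 : continuous (fun a : (R * R)%type => sin a.1).
  by move=> {}a; apply: continuous_comp; [exact: cvg_fst|exact: continuous_sin].
have E a' := @coord_point4 R (cos a'.1) (sin a'.1) a'.2 0.
case; apply: ord2P; have [E1 E2 E3 E4] := E a; rewrite ?(E1, E2, E3, E4).
- by under eq_fun => z do [have [_ -> _ _] := E z]; exact: c2.
- by under eq_fun => z do [have [_ _ _ ->] := E z]; exact: cvg_cst.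
- by under eq_fun => z do [have [-> _ _ _] := E z]; exact: c1.
- by under eq_fun => z do [have [_ _ -> _] := E z]; exact: cvg_snd.
Qed.

Lemma Rintegral_le_cst (f : R -> R) (a b C : R) : a < b ->
  (forall t, a <= t <= b -> {for t, continuous f}) ->
  (forall t, a <= t <= b -> f t <= C) ->
  \int[lebesgue_measure]_(t in `[a, b]) f t <= (b - a) * C.
Proof.
move=> ab cf fC.
apply: (@le_trans _ _ (\int[lebesgue_measure]_(t in `[a, b]) (fun=> C) t)).
  apply: le_Rintegral.
  - exact: measurable_itv.
  - apply: continuous_compact_integrable; first exact: segment_compact.
    by apply: continuous_in_subspaceT => t; rewrite inE/= in_itv/=; exact: cf.
  - apply: continuous_compact_integrable; first exact: segment_compact.
    by apply: continuous_subspaceT; exact: cst_continuous.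
  - by move=> t; rewrite /= in_itv/=; exact: fC.
have mu2 : lebesgue_measure (`[a, b]%classic : set R) = (b - a)%:E.
  by rewrite lebesgue_measure_itv/= lte_fin ab EFinB.
rewrite Rintegral_cst; last exact: measurable_itv.
by rewrite [X in fine X]mu2 /= (mulrC C).
Qed.

Lemma continuous_pairl (s : R) : continuous (fun t : R => (t, s)).
Proof.
move=> t; exact: (@cvg_pair R R R (nbhs t) (nbhs t) (nbhs s) _ _ _ id (fun=> s) cvg_id (cvg_cst s)).
Qed.

Lemma not_pseudoconvex_Omega : ~ pseudoconvex Omega.
Proof.
move=> [u [[cu pshu] exh]].
pose b : R := 50.
have b0 : 0 < b by rewrite /b; lra.
have b2 : b ^+ 2 = 2500 by rewrite /b; ring.
pose phi (a : R * R) := point4 (cos a.1) (sin a.1) a.2 0.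
(* The height [b] is included: the circles then form a compact subset of the domain, on which [u] is
   bounded. *)
pose T : set (R * R) := `[0, 2 * pi] `*` `[0, b].
have TO a : T a -> Omega (phi a).
  move=> [_]; rewrite /= in_itv/= => /andP[a0 ab].
  apply: disc_Omega; first by rewrite cos2Dsin2.
  rewrite cos2Dsin2; have : a.2 ^+ 2 <= b ^+ 2 by rewrite ler_sqr ?nnegrE// ltW.
  by rewrite b2; lra.
have cuphi a : T a -> {for a, continuous (u \o phi)}.
  by move=> Ta; apply: continuous_comp; [exact: continuous_circle_point4|exact: cu (TO _ Ta)].
have [C HC] : exists C : R, forall a, T a -> u (phi a) <= C.
  have cT : compact T by apply: compact_setX; exact: segment_compact.
  have : compact ((u \o phi) @` T).
    apply: continuous_compact => //; apply: continuous_in_subspaceT => a.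
    by rewrite inE => Ta; exact: cuphi.
  move=> /compact_bounded[C [_ HC]]; exists (C + 1) => a Ta.
  by apply: le_trans (ler_norm _) _; apply: HC; [rewrite ltrDl|exists a].
(* The sub-mean value inequality carries the bound from the circle to the centre of its disc. *)
have uC s : 0 <= s < b -> u (point4 0 0 s 0) <= C.
  move=> /andP[s0 sb].
  have sb2 : s ^+ 2 < 2500 by rewrite -b2 ltr_sqr ?nnegrE// ltW.
  have := pshu (point4 0 0 s 0) (point4 1 0 0 0).
  have disc (z : R[i]) : `|z| <= 1 -> Omega (point4 0 0 s 0 + z *: point4 1 0 0 0).
    case: z => x y /Re_le; rewrite Re_normE/= => h.
    rewrite point4_disc; apply: disc_Omega.
      move: h; rewrite -[leRHS]sqrtr1 ler_sqrt//.
    by have := sqr_ge0 x; have := sqr_ge0 y; lra.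
  move=> /(_ disc) /le_trans; apply.
  have E t : point4 0 0 s 0 + cis t *: point4 1 0 0 0 = phi (t, s).
    by rewrite /cis point4_disc.
  have pi2 : 0 < 2 * pi :> R by rewrite mulr_gt0// pi_gt0.
  have Tt t : 0 <= t <= 2 * pi -> T (t, s).
    by move=> tp; split => /=; rewrite in_itv/= ?tp// s0 ltW.
  rewrite ler_pdivrMl// -[X in X * C]subr0; apply: Rintegral_le_cst => // t tp.
    have Ef : (fun t : R => u (point4 0 0 s 0 + cis t *: point4 1 0 0 0)) =
        (u \o phi) \o (fun t : R => (t, s)) by apply/funext => r /=; rewrite E.
    have cf : {for t, continuous ((u \o phi) \o (fun t : R => (t, s)))}.
      apply: continuous_comp; first exact: continuous_pairl.
      exact: cuphi (Tt _ tp).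
    by rewrite -Ef in cf; exact: cf.
  by rewrite E; apply: HC; apply: Tt.
(* Sublevel sets are strict, hence [C + 1]. This one contains every centre with [0 <= s < b], so its
   closure contains their limit, which lies outside the domain. *)
have [_ /(_ (point4 0 0 b 0))] := exh (C + 1).
have nO : ~ Omega (point4 0 0 b 0).
  by rewrite /Omega/= rho_point4 psi0 b2 expr0n/=; rewrite (_ : _ - 2500 = 0) ?ltxx//; ring.
move=> h; apply/nO/h => A /nbhs_coord[e e0 eA].
pose s := Order.max 0 (b - e / 2).
have s0 : 0 <= s by rewrite le_max lexx.
have sb : s < b by rewrite gt_max b0/=; lra.
have se : b - e / 2 <= s by rewrite le_max lexx orbT.
exists (point4 0 0 s 0); split.
  split; last by apply: le_lt_trans (uC s _) _; rewrite ?s0 ?sb// ltrDl.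
  have sb2 : s ^+ 2 < 2500 by rewrite -b2 ltr_sqr ?nnegrE// ltW.
  apply: disc_Omega; rewrite expr0n/= addr0; first by lra.
  by lra.
have [E1 E2 E3 E4] := @coord_point4 R 0 0 b 0.
apply: eA; apply: point4_near; rewrite ?(E1, E2, E3, E4) ?subrr ?normr0//.
by rewrite ger0_norm; lra.
Qed.

End WigglyDomain.

Theorem proposition1p2 (R : realType) :
  exists Om E : set (Cn R 2),
    [/\ domain Om /\ bounded_set Om,
        ~ pseudoconvex Om,
        C11_smooth_boundary Om,
        closed E /\ E `<=` boundary Om &
        [/\ boundary Om `<=` closure (boundary Om `\` E),
            forall p, (boundary Om `\` E) p -> C2_smooth_at Om p &
            forall p, (boundary Om `\` E) p ->
              exists U : set (Cn R 2), [/\ open U, U p &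
                forall q, U q -> boundary Om q -> strictly_pseudoconvex_at Om q]]].
Proof.
have [K [psi [g [cK dK psiE [g_lip g_le g_loc] [psi0 psi_ge0 psi_ge]]]]] := @wiggly_profile R.
have spc p : (boundary (Omega psi) `\` exceptional K psi) p -> generic K p /\ boundary (Omega psi) p.
  by move=> [bp nE]; split => //; apply: contrapT => nG; apply: nE.
exists (Omega psi), (exceptional K psi); split.
- split; last exact: bounded_Omega.
  by split; [exact: open_Omega|exact: connected_Omega|exists 0; exact: Omega0].
- exact: not_pseudoconvex_Omega.
- exact: C11_Omega.
- by split; [exact: closed_exceptional|move=> ? []].
- split; first exact: dense_generic.
  + by move=> p /spc[Gp bp]; have [] := spc_Omega K psi g cK psiE g_lip g_le g_loc psi0 psi_ge0 _ Gp bp.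
  + by move=> p /spc[Gp bp]; have [] := spc_Omega K psi g cK psiE g_lip g_le g_loc psi0 psi_ge0 _ Gp bp.
Qed.
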